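(* There is a family of chain homotopies $$\{S_{G,g}\colon\mathrm{id}_{\mathbb ZBG_*}\simeq\mu_g\mid G \text{ is a group},\ g\in G\}$$ which is uniformly controlled by the function $\delta_{\mathrm{conj}}(k):=k+1$. The chain homotopy $S_{G,g}$ is natural with respect to $(G,g)$, in the sense that $fS_{G,g}=S_{\Gamma,f(g)}f$ for any homomorphism $f\colon G\to\Gamma$.
   Context: For a group $G$, $\mathbb ZBG_*$ is the chain complex with $\mathbb ZBG_n$ the free abelian group with basis $\{[g_1,\ldots,g_n]\mid g_i\in G\}$ and boundary $\partial=\sum_{i=0}^n(-1)^id_i$, where $d_0[g_1,\ldots,g_n]=[g_2,\ldots,g_n]$, $d_i[g_1,\ldots,g_n]=[g_1,\ldots,g_{i-1},g_ig_{i+1},g_{i+2},\ldots,g_n]$ for $0<i<n$, and $d_n[g_1,\ldots,g_n]=[g_1,\ldots,g_{n-1}]$. For a homomorphism $f$, the induced chain map is also denoted $f$: $f[g_1,\ldots,g_n]=[f(g_1),\ldots,f(g_n)]$. For $g\in G$, $\mu_g\colon G\to G$ is $\mu_g(h)=ghg^{-1}$. A chain homotopy $P\colon\phi\simeq\psi$ satisfies $P\partial+\partial P=\psi-\phi$. The diameter of a chain $u=\sum n_\alpha e_\alpha$ in a based chain complex is $d(u)=\sum|n_\alpha|$; the diameter function of $P\colon C_*\to D_{*+1}$ is $d_P(k)=\max\{d(P(c))\mid c\in C_i\text{ a basis element},\ i\le k\}$; a family $\{P_A\}$ is uniformly controlled by $\delta$ if $d_{P_A}(k)\le\delta(k)$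 for all $A$ and $k$. *)

(* Defs.v *)
From HB Require Import structures.
From mathcomp Require Import all_boot.
From mathcomp Require Import ssralg ssrnum ssrint zify.
From mathcomp Require Export freeg.

Set Implicit Arguments.
Unset Strict Implicit.
Unset Printing Implicit Defensive.

Import GRing.Theory.
Local Open Scope ring_scope.

(* freeg only states additivity of [fglift f] as a lemma: [lin_ext f] is
   [fglift f] equipped with the corresponding structure. *)
Definition lin_ext (K L : choiceType) (f : K -> {freeg L / int}) :
  {freeg K / int} -> {freeg L / int} := fglift f.

HB.instance Definition _ (K L : choiceType) (f : K -> {freeg L / int}) :=
  GRing.isZmodMorphism.Build {freeg K / int} {freeg L / int} (lin_ext f)
    (lift_is_additive f).

Lemma lin_extU (K L : choiceType) (f : K -> {freeg L / int}) (x : K) :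
  lin_ext f << x >> = f x.
Proof. by rewrite /lin_ext liftU scale1r. Qed.

Lemma freeg_additive_eq (K : choiceType) (M : zmodType)
    (f g : {additive {freeg K / int} -> M}) :
  (forall x, f << x >> = g << x >>) -> f =1 g.
Proof.
move=> fg u; rewrite -[u]freeg_sumE !raddf_sum; apply: eq_bigr => x _.
have -> : << coeff x u *g x >> = << x >> *~ coeff x u :> {freeg K / int}.
  by rewrite freegU_mulz intz.
by rewrite !raddfMz fg.
Qed.

(* Complexes are indexed by [nat]: the boundary vanishes on degree 0. *)
Record based_complex := BasedComplex {
  basis : nat -> choiceType;
  bd : forall n, {additive {freeg (basis n.+1) / int} ->
                           {freeg (basis n) / int}};
  bd_bd : forall n (u : {freeg (basis n.+2) / int}), bd n (bd n.+1 u) = 0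
}.
Arguments bd : clear implicits.

Notation chains C n := {freeg (basis C n) / int}.

Record chain_map (C D : based_complex) := ChainMap {
  cmap :> forall n, {additive chains C n -> chains D n};
  cmap_bd : forall n (u : chains C n.+1),
    cmap n (bd C n u) = bd D n (cmap n.+1 u)
}.

Definition chain_id (C : based_complex) : chain_map C C :=
  @ChainMap C C (fun n => idfun) (fun n u => erefl).

(* [hmap 0 \o bd = 0] in degree 0, hence the two clauses. *)
Record chain_homotopy (C D : based_complex) (phi psi : chain_map C D) :=
  ChainHomotopy {
  hmap :> forall n, {additive chains C n -> chains D n.+1};
  hmap_bd0 : forall u : chains C 0,
    bd D 0 (hmap 0 u) = psi 0 u - phi 0 u;
  hmap_bdS : forall n (u : chains C n.+1),
    hmap n (bd C n u) + bd D n.+1 (hmap n.+1 u) = psi n.+1 u - phi n.+1 u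
}.

Definition diameter (K : choiceType) (u : {freeg K / int}) : nat :=
  (\sum_(x <- dom u) `|coeff x u|)%N.

(* [d] is the diameter function of [P]; a relation, because the maximum over a
   possibly infinite basis need not exist. *)
Definition is_diameter_function (C D : based_complex) (phi psi : chain_map C D)
    (P : chain_homotopy phi psi) (d : nat -> nat) : Prop :=
  forall k,
    (exists i, exists c : basis C i, (i <= k)%N /\ d k = diameter (P i << c >>))
    /\ (forall i (c : basis C i), (i <= k)%N -> (diameter (P i << c >>) <= d k)%N).

Definition uniformly_controlled (A : Type) (C D : A -> based_complex)
    (phi psi : forall a, chain_map (C a) (D a))
    (P : forall a, chain_homotopy (phi a) (psi a)) (delta : nat -> nat) : Prop :=
  forall a, exists2 d, is_diameter_function (P a) d &
    forall k, (d k <= delta k)%N.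

Section Bar.
Variable G : groupType.

(* With t = [g_1, ..., g_(n+1)], the entry of index j (from 0) of d_i t is
   g_(j+1) if j + 1 < i, g_(j+1) g_(j+2) if j + 1 = i, and g_(j+2) if
   j + 1 > i.  The outer faces are i = 0, where only the last case occurs, and
   i = n + 1, where only the first one does; see [face_first], [face_inner]
   and [face_last]. *)
Definition face n (i : nat) (t : n.+1.-tuple G) : n.-tuple G :=
  [tuple (if (j.+1 < i)%N then nth 1%g t j
          else if j.+1 == i then (nth 1 t j * nth 1 t j.+1)%g
          else nth 1%g t j.+1) | j < n].

Arguments face : simpl never.

Lemma size_face n i (t : n.+1.-tuple G) : size (face i t) = n.
Proof. exact: size_tuple. Qed.

Lemma nth_face n i (t : n.+1.-tuple G) j : (j < n)%N ->
  nth 1%g (face i t) j =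
  (if (j.+1 < i)%N then nth 1%g t j
   else if j.+1 == i then (nth 1 t j * nth 1 t j.+1)%g
   else nth 1%g t j.+1).
Proof. by move=> jn; rewrite -(tnth_nth 1%g _ (Ordinal jn)) tnth_mktuple. Qed.

Lemma face_first n (t : n.+1.-tuple G) : face 0 t = behead t :> seq G.
Proof.
apply: (@eq_from_nth _ 1%g); first by rewrite size_behead !size_tuple.
by move=> j; rewrite size_face => jn; rewrite nth_face // nth_behead.
Qed.

Lemma face_last n (t : n.+1.-tuple G) : face n.+1 t = take n t :> seq G.
Proof.
apply: (@eq_from_nth _ 1%g); first by rewrite size_takel ?size_tuple.
by move=> j; rewrite size_face => jn; rewrite nth_face // nth_take // ltnS jn.
Qed.

Lemma face_inner n i (t : n.+1.-tuple G) : (0 < i < n.+1)%N ->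
  face i t = take i.-1 t ++ (nth 1 t i.-1 * nth 1 t i)%g :: drop i.+1 t
    :> seq G.
Proof.
case: i => // i iltn; rewrite succnK; apply: (@eq_from_nth _ 1%g).
  by rewrite size_face size_cat size_take_min /= size_drop size_tuple; lia.
move=> j; rewrite size_face => jn; rewrite nth_face // nth_cat size_takel;
  last by rewrite size_tuple; lia.
rewrite ltnS eqSS; case: ltngtP => [ji|ij|->].
- by rewrite nth_take.
- by rewrite -subnSK //= nth_drop; congr nth; lia.
- by rewrite subnn.
Qed.

Lemma face_face n (t : n.+2.-tuple G) i j : (j < i)%N ->
  face j (face i t) = face i.-1 (face j t).
Proof.
case: i => // i; rewrite ltnS succnK => ji; apply/val_inj.
suff: face j (face i.+1 t) = face i (face j t) :> seq G by [].
apply: (@eq_from_nth _ 1%g); first by rewrite !size_face.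
move=> k; rewrite size_face => kn.
rewrite [LHS]nth_face // [RHS]nth_face // !nth_face; try lia.
by do ?[case: ltngtP => ?]; try lia; rewrite ?mulgA //; congr (nth _ _ _); lia.
Qed.

Definition bar_bd n :
    {freeg (n.+1.-tuple G) / int} -> {freeg (n.-tuple G) / int} :=
  lin_ext (fun t : n.+1.-tuple G =>
    \sum_(i < n.+2) (-1) ^+ i *: << face i t >>).

HB.instance Definition _ n := GRing.Additive.on (@bar_bd n).

Lemma bar_bdU n (t : n.+1.-tuple G) :
  bar_bd << t >> = \sum_(i < n.+2) (-1) ^+ i *: << face i t >>.
Proof. exact: lin_extU. Qed.

Lemma bar_bd_bd n u : bar_bd (@bar_bd n.+1 u) = 0.
Proof.
pose z : {additive {freeg (n.+2.-tuple G) / int} -> {freeg (n.-tuple G) / int}} :=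
  \0.
apply: (@freeg_additive_eq _ _ (@bar_bd n \o @bar_bd n.+1) z) => t /=.
rewrite bar_bdU raddf_sum /=.
under eq_bigr => i _ do rewrite -signr_odd raddfZsign /= bar_bdU scaler_sumr.
rewrite pair_big /=.
pose h (p : 'I_n.+3 * 'I_n.+2) : 'I_n.+3 * 'I_n.+2 :=
  if (p.2 < p.1)%N then (inord p.2, inord p.1.-1) else (inord p.2.+1, inord p.1).
have hv p : (h p).1 = (if (p.2 < p.1)%N then p.2 : nat else p.2.+1) :> nat /\
            (h p).2 = (if (p.2 < p.1)%N then p.1.-1 else p.1) :> nat.
  case: p => -[i ilt] [j jlt]; rewrite /h /=; case: ltnP => ij /=;
  rewrite !inordK //; lia.
have hK : involutive h.
  move=> p; have [h1 h2] := hv p; have [h3 h4] := hv (h p).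
  case: p (h p) (h (h p)) h1 h2 h3 h4 => i j [i1 j1] [i2 j2] /= h1 h2 h3 h4.
  congr pair; apply: val_inj => /=; move: h1 h2 h3 h4;
  do ?[case: ltnP => ?]; lia.
rewrite (bigID (fun p : 'I_n.+3 * 'I_n.+2 => p.2 < p.1)%N) /= addrC.
rewrite (reindex_inj (inv_inj hK)) /=.
have hP p : ~~ ((h p).2 < (h p).1)%N = (p.2 < p.1)%N.
  by have [-> ->] := hv p; case: (ltnP p.2 p.1) => ?; lia.
rewrite (eq_bigl _ _ hP) -big_split big1 //= => p pP.
have [-> ->] := hv p; rewrite pP (face_face _ pP) !scalerA -scalerDl.
case: p pP => -[[|i] ilt] [j jlt] //= _.
by rewrite -[~~ odd i]/(odd i.+1) !signr_odd exprS mulN1r mulNr mulrC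
  subrr scale0r.
Qed.

Definition bar_complex : based_complex :=
  @BasedComplex (fun n => n.-tuple G) (fun n => @bar_bd n) bar_bd_bd.

Definition conjugation (g h : G) : G := (g * h * g^-1)%g.

Lemma conjugation_multiplicative g : {morph conjugation g : x y / (x * y)%g}.
Proof. by move=> x y; rewrite /conjugation !mulgA mulgVK. Qed.

HB.instance Definition _ g :=
  isMultiplicative.Build G G (conjugation g) (conjugation_multiplicative g).

End Bar.

Definition delta_conj (k : nat) : nat := (k + 1)%N.

Section BarMap.
Variables (G H : groupType) (f : {multiplicative G -> H}).

Definition bar_fun n :
    {freeg (n.-tuple G) / int} -> {freeg (n.-tuple H) / int} :=
  lin_ext (fun t : n.-tuple G => << map_tuple f t >>).

HB.instance Definition _ n := GRing.Additive.on (@bar_fun n).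

Lemma bar_funU n (t : n.-tuple G) : bar_fun << t >> = << map_tuple f t >>.
Proof. exact: lin_extU. Qed.

Lemma face_map n (t : n.+1.-tuple G) i :
  face i (map_tuple f t) = map_tuple f (face i t).
Proof.
apply/val_inj; suff: face i (map_tuple f t) = map f (face i t) :> seq H by [].
apply: (@eq_from_nth _ 1%g) => [|j].
  by rewrite size_face size_map size_face.
rewrite size_face => jn; rewrite (nth_map 1%g) ?size_face // !nth_face //.
rewrite !(nth_map 1%g) ?size_tuple ?ltnS //; last exact: ltnW.
by do ?case: ifP => // _; rewrite gmulfM.
Qed.

Lemma bar_fun_bd n (u : {freeg (n.+1.-tuple G) / int}) :
  bar_fun (bar_bd u) = bar_bd (bar_fun u).
Proof.
apply: (@freeg_additive_eq _ _ (@bar_fun n \o @bar_bd G n)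
  (@bar_bd H n \o @bar_fun n.+1)) => t /=.
rewrite bar_funU !bar_bdU raddf_sum; apply: eq_bigr => i _.
by rewrite -signr_odd raddfZsign /= bar_funU face_map.
Qed.

Definition bar_map : chain_map (bar_complex G) (bar_complex H) :=
  @ChainMap (bar_complex G) (bar_complex H) (fun n => @bar_fun n) bar_fun_bd.

End BarMap.

(* Main.v *)
Require Import Defs.
From mathcomp Require Import all_boot ssralg ssrint.
From HB Require Import structures.
From mathcomp Require Import zify.
From mathcomp Require Import boolp.

(** Conjugation by g is naturally isomorphic to the identity as an endofunctor of
    the one-object category G: the single component of the transformation is
    g^-1, and naturality is the identity g^-1 (g h g^-1) = h g^-1.  A natural
    transformation induces a simplicial homotopy of nerves, whose i-th prism
    follows the identity along the first i arrows, crosses over by g^-1, and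
    then follows the conjugates:
      [g_1, .., g_n] |-> [g_1, .., g_i, g^-1, g g_(i+1) g^-1, .., g g_n g^-1].
    The chain homotopy S is the alternating sum of the n + 1 prisms for
    0 <= i <= n.

    In the boundary of S t, the two faces of each prism that meet the inserted
    entry cancel against those of the neighbouring prisms
    ([face_prism_diag], which is where naturality enters), leaving only the
    bottom and top ends, mu_g t and t.  The other faces of the prisms are the
    prisms over the faces of t ([face_prism_lower], [face_prism_upper]), with
    a sign opposite to the one they have in S (bd t); [sum_prism] does the
    bookkeeping for both kinds.

    The diameter of S t is at most n + 1 by the triangle inequality, as S t is a
    signed sum of n + 1 basis elements.  S is natural because the prisms are
    written with group operations only.  The diameter function itself is a
    maximum over an infinite basis; it exists because a nonempty bounded set of
    natural numbers has a greatest element ([diameter_function_exists]). *)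

Set Implicit Arguments.
Unset Strict Implicit.
Unset Printing Implicit Defensive.

Import GRing.Theory.

Local Open Scope ring_scope.

(** * Diameters of chains *)

Section Diameter.
Variable K : choiceType.
Implicit Types u v : {freeg K / int}.

(** Used to evaluate both terms of a sum on the support of that sum, which need
    not be contained in, or contain, the support of either term. *)
Lemma sum_coeff_le_diameter u (s : seq K) :
  uniq s -> (\sum_(x <- s) `|coeff x u| <= diameter u)%N.
Proof.
move=> s_uniq; rewrite (bigID (mem (dom u))) /= [X in (_ + X)%N]big1; last first.
  by move=> x xu; rewrite coeff_outdom.
rewrite addn0 /diameter -big_filter.
rewrite [leqRHS](bigID (mem s)) /= -[X in (_ <= X + _)%N]big_filter.
apply: leq_trans (leq_addr _ _); rewrite (perm_big [seq x <- dom u | x \in s]) //.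
apply: uniq_perm; rewrite ?filter_uniq ?uniq_dom //.
by move=> x; rewrite !mem_filter andbC.
Qed.

Lemma diameterD u v : (diameter (u + v)%R <= diameter u + diameter v)%N.
Proof.
apply: leq_trans (leq_add (sum_coeff_le_diameter u (uniq_dom (u + v)%R))
                          (sum_coeff_le_diameter v (uniq_dom (u + v)%R))).
rewrite -big_split leq_sum // => x _ /=; rewrite coeffD.
by move: (coeff x u) (coeff x v) => a b; lia.
Qed.

Lemma diameter_sum I (r : seq I) (F : I -> {freeg K / int}) :
  (diameter (\sum_(i <- r) F i)%R <= \sum_(i <- r) diameter (F i))%N.
Proof.
elim: r => [|i r IHr]; first by rewrite !big_nil /diameter dom0 big_nil.
by rewrite !big_cons; apply: leq_trans (diameterD _ _) _; rewrite leq_add2l.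
Qed.

Lemma diameterU (x : K) : diameter << x >> = 1%N.
Proof.
rewrite /diameter (_ : dom << x >> = [:: x]) ?big_seq1; last exact: domU1.
by rewrite coeffU eqxx.
Qed.

Lemma diameterN u : diameter (- u) = diameter u.
Proof.
rewrite /diameter (perm_big _ (domN_perm_eq u)).
by apply: eq_bigr => x _; rewrite coeffN abszN.
Qed.

Lemma diameter_sign m u : diameter ((-1) ^+ m *: u) = diameter u.
Proof.
by rewrite -signr_odd scaler_sign; case: odd; rewrite ?diameterN.
Qed.

End Diameter.

(** The set of diameters attained in degrees at most k is not decidable in
    general, so its maximum is taken classically; [c0] makes that set nonempty
    for every k, and the bound makes it finite. *)
Lemma diameter_function_exists (C D : based_complex) (phi psi : chain_map C D)
    (P : chain_homotopy phi psi) (c0 : basis C 0) (delta : nat -> nat) :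
    {homo delta : i j / (i <= j)%N} ->
    (forall i (c : basis C i), (diameter (P i << c >>) <= delta i)%N) ->
  exists2 d, is_diameter_function P d & forall k, (d k <= delta k)%N.
Proof.
move=> delta_homo Pdelta.
pose attained k m := `[< exists i, exists c : basis C i,
  (i <= k)%N /\ m = diameter (P i << c >>) >].
have attained_le k m : attained k m -> (m <= delta k)%N.
  move=> /asboolP[i [c [ik ->]]].
  exact: leq_trans (Pdelta i c) (delta_homo _ _ ik).
have attained_ex k : exists m, attained k m.
  by exists (diameter (P 0 << c0 >>)); apply/asboolP; exists 0, c0.
exists (fun k => ex_maxn (attained_ex k) (attained_le k)) => k;
  case: ex_maxnP => m; last by move=> /attained_le.
move=> /asboolP m_att m_max; split=> // i c ik.
by apply: m_max; apply/asboolP; exists i, c.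
Qed.

(** * The prism decomposition *)

(** Here [F i j] stands for the j-th face of the i-th prism.  The double sum is
    split into the terms with j = i or j = i + 1, where the face meets the
    inserted entry, and the rest, which is reindexed by an i-th prism over a j-th
    face: the lower faces j < i come from (i - 1, j) and the upper faces
    j > i + 1 from (i, j - 1).  The two kinds together fill the rectangle
    i < n, j < n + 1 exactly once. *)
Lemma sum_prism (V : zmodType) n (F : nat -> nat -> V) :
  \sum_(i < n.+1) \sum_(j < n.+2) F i j =
  \sum_(i < n.+1) (F i i + F i i.+1) +
  \sum_(i < n) \sum_(j < n.+1) (if (j <= i)%N then F i.+1 j else F i j.+1).
Proof.
(* The range of j must not depend on i for the sums to be shifted below, hence
   the zero-padded summands. *)
have row (i : nat) : (i < n.+1)%N -> \sum_(j < n.+2) F i j =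
    F i i + F i i.+1 + \sum_(j < n.+2) (if (j < i)%N then F i j else 0)
    + \sum_(j < n.+2) (if (i.+1 < j)%N then F i j else 0).
  move=> ilt; have ilt1 : (i < n.+2)%N by lia.
  rewrite -addrA -big_split /=.
  rewrite (bigD1 (Ordinal ilt1)) //=.
  rewrite (bigD1 (Ordinal (ilt : i.+1 < n.+2)%N)) /=; last first.
    by rewrite -val_eqE /=; lia.
  rewrite addrA; congr (_ + _).
  rewrite [RHS](bigD1 (Ordinal ilt1)) //=.
  rewrite [in RHS](bigD1 (Ordinal (ilt : i.+1 < n.+2)%N)) /=; last first.
    by rewrite -val_eqE /=; lia.
  have [le_iS lt_Si] : (i.+1 < i)%N = false /\ (i.+1 < i.+1)%N = false by lia.
  rewrite !(ltnn i) le_iS lt_Si !addr0 !add0r.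
  apply: eq_bigr => j; rewrite -!val_eqE /= => /andP[ji ji1].
  by do 2?[case: ltnP => ?]; rewrite ?addr0 ?add0r //; lia.
rewrite (eq_bigr _ (fun (i : 'I_n.+1) _ => row i (ltn_ord i))).
rewrite !big_split /= -!addrA.
(* Row 0 has no lower face and row n no upper face; dropping them shifts the
   index of the lower rows by one. *)
congr (_ + (_ + _)); rewrite big_ord_recl big1 ?add0r /=; last by [].
rewrite [X in _ + X]big_ord_recr [X in _ + (_ + X)]big1 ?addr0 /=; last first.
  by move=> j _; rewrite ltnNge -ltnS ltn_ord.
rewrite -big_split; apply: eq_bigr => i _ /=.
rewrite big_ord_recr [X in _ + X]big_ord_recl /= ltnS.
rewrite (_ : (n < i)%N = false) ?addr0 ?add0r; last by have := ltn_ord i; lia.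
rewrite -big_split; apply: eq_bigr => j _ /=.
by rewrite /bump /= !add1n !ltnS; case: leqP; rewrite ?addr0 ?add0r.
Qed.

Section Prism.
Variable G : groupType.

(** The index [i] is an unconstrained natural number: for [i = n + 1] every entry
    comes from [t], padded with 1 at the end.  This extra prism is an artefact
    that lets the telescoping sum run one step past the last prism. *)
Definition prism (g : G) n (i : nat) (t : n.-tuple G) : n.+1.-tuple G :=
  [tuple (if (j < i)%N then nth 1%g t j
          else if j == i :> nat then g^-1%g
          else conjugation g (nth 1%g t j.-1)) | j < n.+1].

Variable g : G.

Lemma nth_prism n i (t : n.-tuple G) j : (j < n.+1)%N ->
  nth 1%g (prism g i t) j =
  (if (j < i)%N then nth 1%g t j
   else if j == i then g^-1%g else conjugation g (nth 1%g t j.-1)).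
Proof. by move=> jn; rewrite -(tnth_nth 1%g _ (Ordinal jn)) tnth_mktuple. Qed.

Lemma eq_tuple_nth n (s t : n.-tuple G) :
  (forall k, (k < n)%N -> nth 1%g s k = nth 1%g t k) -> s = t.
Proof.
move=> st; apply/val_inj/(@eq_from_nth _ 1%g); first by rewrite /= !size_tuple.
by move=> k; rewrite /= size_tuple; apply: st.
Qed.

Lemma face_prism_bottom n (t : n.-tuple G) :
  face 0 (prism g 0 t) = map_tuple (conjugation g) t.
Proof.
apply: eq_tuple_nth => k kn; rewrite nth_face //.
rewrite -[LHS]/(nth 1%g (prism g 0 t) k.+1) nth_prism //=.
by rewrite (nth_map 1%g) ?size_tuple.
Qed.

(** The prism of index n + 1 is [t] followed by 1, and its last face drops
    that 1. *)
Lemma face_prism_top n (t : n.-tuple G) : face n.+1 (prism g n.+1 t) = t.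
Proof.
apply: eq_tuple_nth => k kn.
by rewrite nth_face // ltnS kn nth_prism ltnW.
Qed.

(** The only entry that differs before simplification is the product at index
    i, where g^-1 (g h g^-1) = h g^-1 for the entry h of [t] there. *)
Lemma face_prism_diag n (t : n.-tuple G) i :
  face i.+1 (prism g i t) = face i.+1 (prism g i.+1 t).
Proof.
apply: eq_tuple_nth => k kn; rewrite !nth_face // !nth_prism; try lia.
do ?[case: ltngtP => ?]; try lia; rewrite //=.
have -> : k = i by lia.
by rewrite /conjugation !mulgA mulVg mul1g.
Qed.

(** The bound on [i] excludes the padded prism, where the face would multiply
    by the padding. *)
Lemma face_prism_lower n (t : n.+1.-tuple G) i j : (j <= i <= n)%N ->
  face j (prism g i.+1 t) = prism g i (face j t).
Proof.
move=> /andP[ji le_in]; apply: eq_tuple_nth => k kn.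
rewrite nth_face // !nth_prism; try lia.
case: (ltngtP k i) => ki.
- by rewrite nth_face; last lia; do ?[case: ltngtP => ?]; try lia.
- case: k kn ki => // k kn ki; rewrite (@nth_face _ _ _ t k) //.
  by do ?[case: ltngtP => ?]; try lia; rewrite //= conjugation_multiplicative.
- by do ?[case: ltngtP => ?]; try lia.
Qed.

Lemma face_prism_upper n (t : n.+1.-tuple G) i j : (i < j <= n.+1)%N ->
  face j.+1 (prism g i t) = prism g i (face j t).
Proof.
move=> /andP[ij le_jn]; apply: eq_tuple_nth => k kn.
rewrite nth_face // !nth_prism; try lia.
case: (ltngtP k i) => ki.
- by rewrite nth_face; last lia; do ?[case: ltngtP => ?]; try lia.
- case: k kn ki => // k kn ki; rewrite (@nth_face _ _ _ t k) //.
  by do ?[case: ltngtP => ?]; try lia; rewrite //= conjugation_multiplicative.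
- by do ?[case: ltngtP => ?]; try lia.
Qed.

(** * The chain homotopy *)

Definition conj_homotopy n :
    {freeg (n.-tuple G) / int} -> {freeg (n.+1.-tuple G) / int} :=
  lin_ext (fun t : n.-tuple G =>
    \sum_(i < n.+1) (-1) ^+ i *: << prism g i t >>).

HB.instance Definition _ n := GRing.Additive.on (@conj_homotopy n).

Lemma conj_homotopyU n (t : n.-tuple G) :
  conj_homotopy << t >> = \sum_(i < n.+1) (-1) ^+ i *: << prism g i t >>.
Proof. exact: lin_extU. Qed.

(** Stated for all n at once: in degree 0 the double sum is empty, and in
    positive degree it is the part that cancels against [conj_homotopy] of the
    boundary of [t]. *)
Lemma bar_bd_conj_homotopy n (t : n.-tuple G) :
  bar_bd (conj_homotopy << t >>) =
  << map_tuple (conjugation g) t >> - << t >> +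
  \sum_(i < n) \sum_(j < n.+1)
    (if (j <= i)%N then (-1) ^+ (i.+1 + j) *: << face j (prism g i.+1 t) >>
     else (-1) ^+ (i + j.+1) *: << face j.+1 (prism g i t) >>).
Proof.
pose F i j : {freeg (n.-tuple G) / int} :=
  (-1) ^+ (i + j) *: << face j (prism g i t) >>.
rewrite conj_homotopyU raddf_sum /=.
transitivity (\sum_(i < n.+1) \sum_(j < n.+2) F i j).
  apply: eq_bigr => i _; rewrite -signr_odd raddfZsign /= signr_odd.
  rewrite bar_bdU scaler_sumr.
  by apply: eq_bigr => j _; rewrite scalerA -exprD.
rewrite sum_prism; congr (_ + _).
(* A (n + 1) is a face of the padded prism, namely t. *)
pose A i : {freeg (n.-tuple G) / int} := << face i (prism g i t) >>.
transitivity (\sum_(0 <= i < n.+1) (A i - A i.+1)).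
  rewrite big_mkord; apply: eq_bigr => i _.
  rewrite /F /A face_prism_diag addnS exprS.
  by rewrite addnn -signr_odd odd_double expr0 mulr1 scale1r scaleN1r.
under eq_bigr => i _ do rewrite -opprB.
by rewrite sumrN telescope_sumr // opprB /A face_prism_bottom face_prism_top.
Qed.

Lemma conj_homotopy_bd0 (u : {freeg (0.-tuple G) / int}) :
  bar_bd (conj_homotopy u) = bar_fun (conjugation g) u - u.
Proof.
apply: (@freeg_additive_eq _ _ (@bar_bd G 0 \o @conj_homotopy 0)
  (@bar_fun _ _ (conjugation g) 0 \- idfun)) => t /=.
by rewrite bar_bd_conj_homotopy big_ord0 addr0 bar_funU.
Qed.

Lemma conj_homotopy_bdS n (u : {freeg (n.+1.-tuple G) / int}) :
  conj_homotopy (bar_bd u) + bar_bd (conj_homotopy u) =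
  bar_fun (conjugation g) u - u.
Proof.
apply: (@freeg_additive_eq _ _
  ((@conj_homotopy n \o @bar_bd G n) \+ (@bar_bd G n.+1 \o @conj_homotopy n.+1))
  (@bar_fun _ _ (conjugation g) n.+1 \- idfun)) => t /=.
rewrite bar_bd_conj_homotopy bar_funU addrC -addrA -[RHS]addr0; congr (_ + _).
rewrite bar_bdU raddf_sum /= exchange_big -big_split big1 //= => j _.
rewrite -signr_odd raddfZsign /= signr_odd conj_homotopyU scaler_sumr.
rewrite -big_split big1 //= => i _; rewrite scalerA -exprD.
have [lt_in lt_jn] := (ltn_ord i, ltn_ord j).
case: leqP => ij.
  rewrite face_prism_lower; last by rewrite ij -ltnS.
  by rewrite addSn exprS mulN1r scaleNr addnC addNr.
rewrite face_prism_upper; last by rewrite ij -ltnS.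
by rewrite addnS exprS mulN1r scaleNr addnC addNr.
Qed.

Definition conjugation_homotopy :
    chain_homotopy (chain_id (bar_complex G)) (bar_map (conjugation g)) :=
  @ChainHomotopy _ _ (chain_id (bar_complex G)) (bar_map (conjugation g))
    (fun n => @conj_homotopy n) conj_homotopy_bd0 conj_homotopy_bdS.

Lemma diameter_conj_homotopy n (t : n.-tuple G) :
  (diameter (conj_homotopy << t >>) <= n.+1)%N.
Proof.
rewrite conj_homotopyU; apply: leq_trans (diameter_sum _ _) _.
rewrite -[leqRHS]muln1 -[X in (_ <= X * _)%N]card_ord -sum_nat_const.
by apply: leq_sum => i _; rewrite diameter_sign diameterU.
Qed.

End Prism.

(** * Naturality *)

(** Between groups, preserving products already forces preserving inverses:
    [f 1] is idempotent, hence [1]. *)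
Lemma multiplicativeV (G H : groupType) (f : {multiplicative G -> H}) x :
  f x^-1%g = (f x)^-1%g.
Proof.
have f1 : f 1%g = 1%g by apply: (mulgI (f 1%g)); rewrite -gmulfM !mulg1.
by apply: (mulIg (f x)); rewrite -gmulfM !mulVg.
Qed.

Lemma map_prism (G H : groupType) (f : {multiplicative G -> H}) (g : G) n i
    (t : n.-tuple G) :
  (i <= n)%N -> map_tuple f (prism g i t) = prism (f g) i (map_tuple f t).
Proof.
move=> le_in; apply: eq_tuple_nth => k kn.
rewrite nth_prism // (nth_map 1%g) ?size_tuple // nth_prism //.
case: ltngtP => ki; rewrite ?multiplicativeV //;
  rewrite (nth_map 1%g) ?size_tuple //; try lia.
by rewrite /conjugation !gmulfM multiplicativeV.
Qed.

Lemma conj_homotopy_natural (G H : groupType) (f : {multiplicative G -> H})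
    (g : G) n (u : {freeg (n.-tuple G) / int}) :
  bar_fun f (conj_homotopy g u) = conj_homotopy (f g) (bar_fun f u).
Proof.
apply: (@freeg_additive_eq _ _ (@bar_fun _ _ f n.+1 \o @conj_homotopy _ g n)
  (@conj_homotopy _ (f g) n \o @bar_fun _ _ f n)) => t /=.
rewrite bar_funU !conj_homotopyU raddf_sum; apply: eq_bigr => i _.
by rewrite -signr_odd raddfZsign /= bar_funU map_prism // -ltnS.
Qed.

Theorem theorem4p7 :
  exists S : forall (G : groupType) (g : G),
      chain_homotopy (chain_id (bar_complex G)) (bar_map (conjugation g)),
    uniformly_controlled
      (fun p : {G : groupType & G} => S (tag p) (tagged p))
      delta_conj
    /\ forall (G H : groupType) (f : {multiplicative G -> H}) (g : G)
         (n : nat) (u : chains (bar_complex G) n),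
         bar_map f n.+1 (S G g n u) = S H (f g) n (bar_map f n u).
Proof.
exists (fun G g => conjugation_homotopy g); split; last first.
  by move=> G H f g n u; apply: conj_homotopy_natural.
move=> [G g]; apply: diameter_function_exists.
- exact: [tuple].
- by move=> i j; rewrite /delta_conj leq_add2r.
- by move=> i t; rewrite /delta_conj addn1; apply: diameter_conj_homotopy.
Qed.
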